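(* Let $L$ be a finite-dimensional solvable Leibniz $A$-algebra over an algebraically closed field $F$. Then the derived length of $L$ is at most $3$.
   Context: A (right) Leibniz algebra over $F$ is a vector space with a bilinear product $[\,,]$ satisfying $[x,[y,z]]=[[x,y],z]-[[x,z],y]$ for all $x,y,z$. Lower central series: $L^1=L$, $L^{k+1}=[L^k,L]$; $L$ is nilpotent if $L^k=0$ for some $k$. Derived series: $L^{(0)}=L$, $L^{(k+1)}=[L^{(k)},L^{(k)}]$; $L$ is solvable of derived length $m$ if $L^{(m)}=0$ but $L^{(m-1)}\ne 0$. $L$ is abelian if $[x,y]=0$ for all $x,y$. $L$ is an $A$-algebra if every nilpotent subalgebra of $L$ is abelian. *)

(* Defs.v *)
From mathcomp Require Import all_boot all_order all_algebra.
Set Implicit Arguments.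
Unset Strict Implicit.
Unset Printing Implicit Defensive.

Import GRing.Theory.
Local Open Scope ring_scope.

Section LeibnizAlgebra.

Variables (F : fieldType) (L : vectType F) (br : {bilinear L -> L -> L}).

Definition right_leibniz :=
  forall x y z : L, br x (br y z) = br (br x y) z - br (br x z) y.

(* [U, V], the span of all br u v with u in U and v in V: by bilinearity a   *)
(* basis of U and a basis of V suffice (see bracketvP).                       *)
Definition bracketv (U V : {vspace L}) : {vspace L} :=
  <<[seq br u v | u <- vbasis U, v <- vbasis V]>>%VS.

Lemma memv_bracket (U V : {vspace L}) u v :
  u \in U -> v \in V -> br u v \in bracketv U V.
Proof.
move=> /coord_vbasis -> /coord_vbasis ->.
rewrite linear_sumlz; apply: memv_suml => i _.
rewrite linear_sumr; apply: memv_suml => j _.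
rewrite linearZl_LR linearZr_LR /= !memvZ // memv_span //.
by apply/allpairsP; exists ((vbasis U)`_i, (vbasis V)`_j); rewrite !memt_nth.
Qed.

Lemma bracketvP (U V W : {vspace L}) :
  reflect (forall u v, u \in U -> v \in V -> br u v \in W)
          (bracketv U V <= W)%VS.
Proof.
apply: (iffP idP) => [sUVW u v Uu Vv | sUVW].
  by apply: (subvP sUVW); apply: memv_bracket.
apply/span_subvP => _ /allpairsP[[u v] /= [Uu Vv ->]].
by apply: sUVW; apply: vbasis_mem.
Qed.

Definition is_subalgebra (U : {vspace L}) := (bracketv U U <= U)%VS.

(* The usual numbering starts at U^1 = U: lower_central U k is U^(k+1).       *)
Definition lower_central (U : {vspace L}) (k : nat) : {vspace L} :=
  iter k (fun W => bracketv W U) U.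

Definition is_nilpotent (U : {vspace L}) :=
  exists k, lower_central U k = 0%VS.

Definition is_abelian (U : {vspace L}) := {in U &, forall x y, br x y = 0}.

Definition is_A_algebra :=
  forall U : {vspace L}, is_subalgebra U -> is_nilpotent U -> is_abelian U.

Definition derived_series (k : nat) : {vspace L} :=
  iter k (fun W => bracketv W W) fullv.

Definition is_solvable := exists m, derived_series m == 0%VS.

(* The least m with L^(m) = 0; it is 0 exactly when L = 0.                    *)
Definition derived_length (solL : is_solvable) : nat := ex_minn solL.

Lemma derived_lengthP (solL : is_solvable) (m : nat) :
  derived_length solL = m <->
  derived_series m = 0%VS /\ ((0 < m)%N -> derived_series m.-1 <> 0%VS).
Proof.
have dS0 k n : (k <= n)%N -> derived_series k = 0%VS -> derived_series n = 0%VS.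
  move=> /subnK <- dk0; elim: (n - k)%N => // i IHi.
  rewrite addSn /derived_series iterS -/(derived_series (i + k)) IHi.
  apply/eqP; rewrite -subv0; apply/bracketvP => u v.
  by rewrite memv0 => /eqP -> _; rewrite linear0l mem0v.
rewrite /derived_length; case: ex_minnP => n /eqP dn0 n_min; split.
  move=> <-; split=> // n_gt0 /eqP /n_min.
  by rewrite leqNgt prednK // leqnn.
case=> dm0 dm1; apply/eqP; rewrite eqn_leq n_min ?dm0 //=.
rewrite leqNgt; apply/negP => lt_nm.
apply: dm1; first exact: leq_ltn_trans lt_nm.
by apply: dS0 dn0; rewrite -ltnS prednK // (leq_ltn_trans _ lt_nm).
Qed.

End LeibnizAlgebra.

(* Main.v *)
(* Every subalgebra S satisfies [[S, S], S] = [S, S], by a Fitting and Engel  *)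
(* argument. If L had derived length n >= 4, put A = L^(n-1), M = L^(n-2) and *)
(* Q = L^(n-3), so that A = [A, M], M = [M, Q] and Q lies in [L, L]. On A the *)
(* right multiplications by elements of M commute and none of them has a      *)
(* nontrivial Jordan block for 0. If w = [x, [y, z]] with x in M did not      *)
(* annihilate A, then [A, w] would contain a nonzero L-submodule on which x,  *)
(* [w, y] and [w, z] act as multiples of the invertible operator w; expanding *)
(* w by the Leibniz identity then makes w act by 0 there. Hence [M, Q] = M    *)
(* annihilates A and A = [A, M] = 0.                                          *)

Require Import Defs.
From mathcomp Require Import all_boot all_order all_algebra.
Set Implicit Arguments.
Unset Strict Implicit.
Unset Printing Implicit Defensive.

Import GRing.Theory.
Local Open Scope ring_scope.

(** The A-property acts through [A_algebra_derived_stable]. Applied to derived terms, it rebuilds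
    each later term from its predecessor; applied to [<x> + A], it gives [last_derived_null], the
    absence of nontrivial Jordan blocks for 0. Algebraic closure enters through
    [exists_eigenvector], which makes the commuting operators on [A] proportional on a nonzero
    submodule ([proportional_submodule]). Then [last_derived_br_commutator] shows that [[M, [L, L]]]
    kills [A]. The bound is 3 because for length [n >= 4] the term [L^(n-3)] still lies in
    [[L, L]]. *)

(** * Descending chains, Fitting decomposition and eigenvectors *)

Section VectorSpaces.

Variables (F : fieldType) (L : vectType F).
Implicit Types (f : 'End(L)) (U W : {vspace L}).

(** Until the chain stabilises each step lowers the dimension, so [\dim {:L}] steps suffice; a chain
    still dropping by then has reached 0. *)
Lemma iter_vspace_stable (g : {vspace L} -> {vspace L}) W :
    (forall k, iter k.+1 g W <= iter k g W)%VS ->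
  g (iter (\dim {:L}) g W) = iter (\dim {:L}) g W.
Proof.
move=> decg.
have: forall k, (\dim (iter k g W) + k <= \dim {:L})%N
             \/ g (iter k g W) = iter k g W.
  elim=> [|k [le_k | fix_k]]; first by left; rewrite addn0 dimvS ?subvf.
    have [eq_k | neq_k] := eqVneq (iter k.+1 g W) (iter k g W).
      by right; rewrite eq_k -[RHS]eq_k.
    left; apply: leq_trans le_k; rewrite addnS ltn_add2r.
    by rewrite ltn_neqAle !(dimv_leqif_eq (decg k)) neq_k.
  by right; rewrite !iterS !fix_k.
move=> /(_ (\dim {:L})) [le_d | //].
have /eqP: iter (\dim {:L}) g W == 0%VS.
  by rewrite -dimv_eq0 -leqn0 -(leq_add2r (\dim {:L})).
move=> W0; apply/eqP; rewrite eqEsubv decg /=.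
by rewrite W0 sub0v.
Qed.

Lemma iter_limgP f k U v :
  reflect (exists2 u, u \in U & v = iter k f u)
          (v \in iter k (fun W => f @: W)%VS U).
Proof.
elim: k v => [|k IHk] v /=.
  by apply: (iffP idP) => [Uv | [u Uu ->] //]; exists v.
apply: (iffP memv_imgP) => [[w /IHk[u Uu ->] ->] | [u Uu ->]].
  by exists u.
by exists (iter k f u) => //; apply/IHk; exists u.
Qed.

Lemma iter_linear0 f k : iter k f 0 = 0.
Proof. by elim: k => //= k ->; rewrite linear0. Qed.

Lemma iter_linearD f k u v : iter k f (u + v) = iter k f u + iter k f v.
Proof. by elim: k => //= k ->; rewrite linearD. Qed.

Lemma iter_linearB f k u v : iter k f (u - v) = iter k f u - iter k f v.
Proof. by elim: k => //= k ->; rewrite linearB. Qed.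

Definition iter_lfun f k : 'End(L) := iter k (fun g => f \o g)%VF \1%VF.

Lemma iter_lfunE f k v : iter_lfun f k v = iter k f v.
Proof. by elim: k => [|k IHk] /=; rewrite ?id_lfunE ?comp_lfunE ?IHk. Qed.

Section Fitting.

Variables (f : 'End(L)) (U : {vspace L}).
Hypothesis fU : (f @: U <= U)%VS.
Let d : nat := \dim {:L}.
Let W := iter d (fun V => f @: V)%VS U.

Lemma fitting_limg : (f @: W)%VS = W.
Proof.
by apply: iter_vspace_stable; elim=> [//|k IHk]; rewrite !iterS limgS.
Qed.

(** [f] maps [W] onto itself, hence is injective there, and [W] contains the [d]-th iterate of
    [v]. *)
Lemma fitting_ker v n : v \in U -> iter n f v = 0 -> iter d f v = 0.
Proof.
move=> Uv fnv0.
have injW: (W :&: lker f)%VS = 0%VS.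
  apply/eqP; rewrite -dimv_eq0 -(eqn_add2r (\dim (f @: W)%VS)).
  by rewrite limg_ker_dim add0n fitting_limg.
have Wfd: iter d f v \in W by apply/iter_limgP; exists v.
have: iter n f (iter d f v) = 0 by rewrite -iterD addnC iterD fnv0 iter_linear0.
elim: n (iter d f v) Wfd {fnv0} => [//|n IHn] w Ww.
rewrite iterSr => /IHn fw0.
have /fw0 fw: f w \in W by rewrite -fitting_limg memv_img.
by apply/eqP; rewrite -memv0 -injW memv_cap Ww memv_ker fw eqxx.
Qed.

(** Since [f^d] maps [W] onto itself, some [w] in [W] has the same [d]-th iterate as [v], and
    [v - w] lies in the null component. *)
Lemma fitting_decomposition :
  (U <= (U :&: lker (iter_lfun f d)) + W)%VS.
Proof.
apply/subvP=> v Uv.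
have Wstable k : iter k (fun V => f @: V)%VS W = W.
  by elim: k => //= k ->; exact: fitting_limg.
have /iter_limgP[w Ww Dfdv]: iter d f v \in iter d (fun V => f @: V)%VS W.
  by rewrite Wstable; apply/iter_limgP; exists v.
have WU: (W <= U)%VS.
  rewrite /W; elim: (d) => //= k IHk; exact: subv_trans (limgS _ IHk) fU.
apply/memv_addP; exists (v - w); last by exists w; rewrite ?subrK.
apply/memv_capP; split; first by rewrite memvB // (subvP WU).
by rewrite memv_ker iter_lfunE iter_linearB Dfdv subrr eqxx.
Qed.

End Fitting.

End VectorSpaces.

Lemma exists_eigenvector (F : closedFieldType) (L : vectType F) (f : 'End(L))
    (V : {vspace L}) :
    V != 0%VS -> (f @: V <= V)%VS ->
  exists a, exists2 v, v \in V & v != 0 /\ f v = a *: v.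
Proof.
rewrite -dimv_eq0 -lt0n => V_gt0 fV.
pose e := vbasis V.
pose A := \matrix_(i < \dim V, j < \dim V) coord e j (f e`_i).
have eV (i : 'I_(\dim V)) : f e`_i \in V.
  rewrite (subvP fV) // memv_img // vbasis_mem //; apply: mem_nth.
  by rewrite size_tuple.
have [a ra] : exists a, eigenvalue A a.
  have /closed_rootP[a]: size (char_poly A) != 1%N.
    by rewrite size_char_poly eqSS -lt0n.
  by rewrite -eigenvalue_root_char; exists a.
have /eigenvalueP[r rA r_neq0] := ra.
exists a, (\sum_i r 0 i *: e`_i).
  apply: memv_suml => i _; rewrite memvZ // vbasis_mem // mem_nth //.
  by rewrite size_tuple.
split.
  have /freeP freeV := basis_free (vbasisP V).
  apply: contraNneq r_neq0 => /(freeV (r 0)) r0.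
  by apply/eqP/rowP=> i; rewrite r0 mxE.
rewrite linear_sum scaler_sumr.
transitivity (\sum_j (r *m A) 0 j *: e`_j); last first.
  by apply: eq_bigr => j _; rewrite rA mxE scalerA.
transitivity (\sum_i \sum_j (r 0 i * A i j) *: e`_j).
  apply: eq_bigr => i _; rewrite linearZ /= (coord_vbasis (eV i)) scaler_sumr.
  by apply: eq_bigr => j _; rewrite scalerA mxE.
rewrite exchange_big; apply: eq_bigr => j _ /=.
by rewrite mxE scaler_suml.
Qed.

(** * Engel's theorem and the stability of [[S, S]] *)

Section LeibnizAlgebras.

Variables (F : fieldType) (L : vectType F) (br : {bilinear L -> L -> L}).
Hypothesis hLeib : right_leibniz br.
Implicit Types (U V W X S T : {vspace L}) (x y z : L).

Let d : nat := \dim {:L}.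

Definition rmul y : 'End(L) := linfun (applyr br y).

Lemma rmulE y x : rmul y x = br x y.
Proof. by rewrite lfunE. Qed.

Lemma rmul_derivation x y z : br (br x y) z = br x (br y z) + br (br x z) y.
Proof. by rewrite hLeib subrK. Qed.

Lemma bracketvS U U' V V' :
  (U <= U')%VS -> (V <= V')%VS -> (bracketv br U V <= bracketv br U' V')%VS.
Proof.
move=> /subvP sU /subvP sV; apply/bracketvP => u v Uu Vv.
by rewrite memv_bracket ?sU ?sV.
Qed.

Lemma subalgebra_br U x y :
  is_subalgebra br U -> x \in U -> y \in U -> br x y \in U.
Proof. by move=> /bracketvP; apply. Qed.

Lemma lower_central_desc U k :
  is_subalgebra br U -> (lower_central br U k.+1 <= lower_central br U k)%VS.
Proof. by move=> algU; elim: k => [//|k IHk]; apply: bracketvS. Qed.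

Lemma bracketv_subl U V W X :
    (forall u v w, u \in U -> v \in V -> w \in W -> br (br u v) w \in X) ->
  (bracketv br (bracketv br U V) W <= X)%VS.
Proof.
move=> UVW; apply/bracketvP => t w UVt Ww; rewrite -rmulE memv_preim.
apply: subvP t UVt; apply/bracketvP => u v Uu Vv.
by rewrite -memv_preim rmulE UVW.
Qed.

Lemma bracketv_subr U V W X :
    (forall u v w, u \in U -> v \in V -> w \in W -> br u (br v w) \in X) ->
  (bracketv br U (bracketv br V W) <= X)%VS.
Proof.
move=> UVW; apply/bracketvP => u t Uu VWt.
have brE v : linfun (br u) v = br u v by rewrite lfunE.
rewrite -brE memv_preim; apply: subvP t VWt; apply/bracketvP => v w Vv Ww.
by rewrite -memv_preim brE UVW.
Qed.

Lemma limg_rmul U V y : y \in V -> (rmul y @: U <= bracketv br U V)%VS.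
Proof.
by move=> Vy; apply/subvP=> _ /memv_imgP[u Uu ->]; rewrite rmulE memv_bracket.
Qed.

(** The Leibniz identity turns a bracket with [[v, w]] on the right into iterated brackets with [v]
    and [w], whence induction on [j]. The extra successor reflects the shifted numbering. *)
Lemma lower_central_br U i j :
  (bracketv br (lower_central br U i) (lower_central br U j)
     <= lower_central br U (i + j).+1)%VS.
Proof.
elim: j i => [|j IHj] i; first by rewrite addn0.
apply: bracketv_subr => u v w Uu Uv Uw; rewrite hLeib; apply: memvB.
  rewrite addnS; apply: memv_bracket Uw.
  by apply: (subvP (IHj i)); apply: memv_bracket.
rewrite -addSnnS; apply: (subvP (IHj i.+1)); apply: memv_bracket => //.
exact: memv_bracket.
Qed.

Lemma derived_series_ideal k :
  (bracketv br (derived_series br k) fullv <= derived_series br k)%VS /\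
  (bracketv br fullv (derived_series br k) <= derived_series br k)%VS.
Proof.
elim: k => [|k [/bracketvP IHr /bracketvP IHl]]; first by rewrite !subvf.
split.
  apply: bracketv_subl => u v w Ku Kv _; rewrite rmul_derivation.
  by rewrite memvD // memv_bracket // IHr // memvf.
apply: bracketv_subr => u v w _ Kv Kw; rewrite hLeib.
by rewrite memvB // memv_bracket // IHl // memvf.
Qed.

Lemma derived_series_brl k x y :
  x \in derived_series br k -> br x y \in derived_series br k.
Proof.
move=> Kx; have [/bracketvP h _] := derived_series_ideal k.
by apply: h; rewrite ?memvf.
Qed.

Lemma derived_series_brr k x y :
  y \in derived_series br k -> br x y \in derived_series br k.
Proof.
move=> Ky; have [_ /bracketvP h] := derived_series_ideal k.
by apply: h; rewrite ?memvf.
Qed.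

Lemma derived_series_br k x y :
    x \in derived_series br k -> y \in derived_series br k ->
  br x y \in derived_series br k.+1.
Proof. exact: memv_bracket. Qed.

Lemma derived_series_desc k l :
  (k <= l)%N -> (derived_series br l <= derived_series br k)%VS.
Proof.
move=> /subnK <-; elim: (l - k)%N => // i IHi; rewrite addSn.
apply: subv_trans IHi; apply/bracketvP => u v Ku _.
exact: derived_series_brl.
Qed.

(* Engel's theorem in a form that avoids quotients: adding to T an element s  *)
(* acting nilpotently preserves this property, because V = [V, T] + [V, s]    *)
(* with [V, T] stable under s forces V = [V, T].                              *)
Definition no_perfect_submodule U T := forall V,
  (V <= U)%VS -> (bracketv br V T <= V)%VS -> (V <= bracketv br V T)%VS ->
  V = 0%VS.

Lemma no_perfect_submoduleD1 U T s :
    (forall v, v \in U -> iter d (rmul s) v = 0) ->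
    (forall t, t \in T -> br t s \in T) ->
  no_perfect_submodule U T -> no_perfect_submodule U (<[s]> + T)%VS.
Proof.
move=> nil_s Ts noT V VU VsT sVT.
have Ss : s \in (<[s]> + T)%VS by apply: subvP (addvSl _ _) _ (memv_line s).
have ST : (T <= <[s]> + T)%VS by apply: addvSr.
have VT : (bracketv br V T <= V)%VS by apply: subv_trans (bracketvS _ ST) VsT.
apply: noT => //; set W := bracketv br V T.
have Ws : (rmul s @: W <= W)%VS.
  apply: subv_trans (limg_rmul _ (memv_line s)) _.
  apply: bracketv_subl => v t _ Vv Tt /vlineP[c ->].
  rewrite linearZr_LR rmul_derivation memvZ // memvD // memv_bracket ?Ts //.
  by apply: (subvP VsT); apply: memv_bracket.
have sVW : (V <= W + rmul s @: V)%VS.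
  apply: subv_trans sVT _.
  apply/bracketvP => v _ Vv /memv_addP[_ /vlineP[c ->] [t Tt ->]].
  rewrite linearDr linearZr_LR -rmulE addrC memv_add ?memv_bracket //.
  by rewrite memvZ ?memv_img.
(* Substituting the inclusion into itself is possible because [W] is stable under [s]; after [d]
   rounds the second summand vanishes. *)
have {sVW} sVWk k : (V <= W + iter k (fun X => rmul s @: X)%VS V)%VS.
  elim: k => [|k IHk]; first exact: addvSr.
  apply: subv_trans sVW _; rewrite subv_add addvSl /=.
  apply: subv_trans (limgS _ IHk) _; rewrite limgD.
  by apply: addvS.
apply: subv_trans (sVWk d) _; rewrite subv_add subvv /=.
apply/subvP=> _ /iter_limgP[v Vv ->].
by rewrite nil_s ?mem0v // (subvP VU).
Qed.

(** Solvability supplies the filtration of [U] by its intersections with the derived series.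
    Starting from 0, each layer is added one spanning vector at a time; the stable term of the lower
    central series is then a perfect submodule, hence 0. *)
Lemma engel U :
    is_solvable br -> is_subalgebra br U ->
    (forall u v, u \in U -> v \in U -> iter d (rmul u) v = 0) ->
  is_nilpotent br U.
Proof.
move=> [m /eqP Lm0] algU nilU.
have noU : forall k,
    no_perfect_submodule U (U :&: derived_series br (m - k))%VS.
  elim=> [|k IHk].
    rewrite subn0 Lm0 capv0 => V _ _ sV0; apply/eqP; rewrite -subv0.
    apply: subv_trans sV0 _; apply/bracketvP => v t _.
    by rewrite memv0 => /eqP ->; rewrite linear0r mem0v.
  have [le_mk | lt_km] := leqP m k.
    by move: IHk; rewrite (eqP le_mk) (_ : m - k.+1 = 0)%N //; apply/eqP/leqW.
  set T := (U :&: _)%VS; set T' := (U :&: _)%VS in IHk.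
  have T'E : (bracketv br T T <= T')%VS.
    apply/bracketvP => u v /memv_capP[Uu Ku] /memv_capP[Uv Kv].
    rewrite memv_cap subalgebra_br //= -(subnSK lt_km).
    exact: derived_series_br.
  have T'T : (T' <= T)%VS.
    by apply: capvS => //; apply: derived_series_desc; rewrite leq_sub2l.
  have noX : forall X : seq L, all (mem T) X ->
      no_perfect_submodule U (<<X>> + T')%VS.
    elim=> [_|s X IHX /= /andP[Ts TX]]; first by rewrite span_nil add0v.
    rewrite span_cons -addvA; apply: no_perfect_submoduleD1; last exact: IHX.
      by move=> v; apply: nilU; have /memv_capP[] := Ts.
    (* The order of the spanning vectors is irrelevant, as all brackets inside [T] fall into
       [T']. *)
    move=> t XTt; apply: (subvP (addvSr _ _)); apply: (subvP T'E).
    apply: memv_bracket => //; apply: subvP XTt; rewrite subv_add T'T andbT.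
    by apply/span_subvP=> x /(allP TX).
  have := noX (vbasis T); rewrite (span_basis (vbasisP T)) (addv_idPl T'T).
  by apply; apply/allP=> x /vbasis_mem.
exists d.
have stable := iter_vspace_stable (fun k => lower_central_desc k algU).
apply: (noU m); rewrite ?subnn ?capvf.
- by elim: (d) => [|k IHk]; rewrite // (subv_trans (lower_central_desc k algU)).
- exact: lower_central_desc.
by rewrite {1}/lower_central -stable.
Qed.

(** Right multiplication by [u] is a derivation, so each application lowers one of the two
    exponents, as in the binomial formula. *)
Lemma iter_rmul_br a b x y u :
    iter a (rmul u) x = 0 -> iter b (rmul u) y = 0 ->
  iter (a + b) (rmul u) (br x y) = 0.
Proof.
have [n] := ubnP (a + b); elim: n a b x y => // n IHn [|a] [|b] x y.
- by move=> _ x0 _; rewrite [x]x0 linear0l iter_linear0.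
- by move=> _ x0 _; rewrite [x]x0 linear0l iter_linear0.
- by move=> _ _ y0; rewrite [y]y0 linear0r iter_linear0.
rewrite addSn !ltnS => ab xa yb; rewrite iterSr rmulE rmul_derivation.
have ab' : (a.+1 + b < n)%N by rewrite addSnnS.
rewrite iter_linearD -{1}addSnnS -(rmulE u x) -(rmulE u y).
by rewrite (IHn _ _ _ _ ab') -?iterSr // (IHn _ _ _ _ ab) -?iterSr // addr0.
Qed.

Lemma fitting_null_subalgebra U u :
    is_subalgebra br U -> u \in U ->
  is_subalgebra br (U :&: lker (iter_lfun (rmul u) d))%VS.
Proof.
move=> algU Uu; apply/bracketvP => x y.
rewrite !memv_cap !memv_ker !iter_lfunE.
move=> /andP[Ux /eqP x0] /andP[Uy /eqP y0].
rewrite subalgebra_br //=; apply/eqP.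
have fU : (rmul u @: U <= U)%VS by apply: subv_trans (limg_rmul _ Uu) algU.
(* The derivation rule gives exponent [d + d], which Fitting brings back to [d]. *)
by apply: (fitting_ker fU) (iter_rmul_br x0 y0); apply: subalgebra_br.
Qed.

Hypotheses (hA : is_A_algebra br) (hsol : is_solvable br).

(* A subalgebra U minimal among those with U + S^omega = S has only nilpotent *)
(* right multiplications, by minimality against Fitting null components, so   *)
(* it is nilpotent, hence abelian, and [S, S] is contained in S^omega.        *)
Lemma A_algebra_derived_stable S :
    is_subalgebra br S ->
  bracketv br (bracketv br S S) S = bracketv br S S.
Proof.
move=> algS; pose N := lower_central br S d.
have Nstable : bracketv br N S = N.
  exact: (iter_vspace_stable (fun k => lower_central_desc k algS)).
have NS k : (N <= lower_central br S k)%VS.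
  elim: k => [|k IHk]; last by rewrite -Nstable; apply: bracketvS.
  rewrite /N; elim: (d) => [|k IHk] //.
  exact: subv_trans (lower_central_desc k algS) IHk.
have SN : (bracketv br S N <= N)%VS.
  rewrite -{2}Nstable; exact: (lower_central_br S 0 d).
suffices S2N : (bracketv br S S <= N)%VS.
  have -> : bracketv br S S = N.
    by apply/eqP; rewrite eqEsubv S2N -{1}Nstable bracketvS // (NS 0).
  exact: Nstable.
apply: contraT => notS2N.
suffices minU n U : (\dim U < n)%N -> is_subalgebra br U -> (U <= S)%VS ->
    (S <= U + N)%VS -> false.
  by rewrite (minU (\dim S).+1 S) ?addvSl.
elim: n U => // n IHn U ltUn algU US SUN.
have nilU u : u \in U -> (U <= lker (iter_lfun (rmul u) d))%VS.
  move=> Uu; set K := lker _.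
  apply: contraT => notUK; apply: (IHn (U :&: K)%VS).
  - apply: leq_trans (_ : \dim U <= n)%N => //.
    rewrite ltn_neqAle !(dimv_leqif_eq (capvSl U K)) andbT.
    by apply: contra notUK => /eqP <-; apply: capvSr.
  - exact: fitting_null_subalgebra.
  - exact: subv_trans (capvSl _ _) US.
  have fU : (rmul u @: U <= U)%VS by apply: subv_trans (limg_rmul _ Uu) algU.
  apply: subv_trans SUN _; rewrite subv_add addvSr andbT.
  apply: subv_trans (fitting_decomposition fU) _; apply: addvS => //.
  (* As [u] lies in [S], the [d]-th image of [U] falls into [N], so the null component still
     supplements [N]. *)
  rewrite /N -/d; elim: (d) => //= k IHk.
  apply: subv_trans (limgS _ IHk) _.
  by apply: limg_rmul; apply: (subvP US).
have abU : is_abelian br U.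
  apply: hA => //; apply: engel => // u v Uu Uv.
  by have := subvP (nilU u Uu) v Uv; rewrite memv_ker iter_lfunE => /eqP.
case/negP: notS2N; apply/bracketvP => x y.
move=> /(subvP SUN) /memv_addP[u Uu [n1 Nn1 ->]] Sy.
rewrite linearDl memvD //; last first.
  by rewrite -Nstable memv_bracket.
have /memv_addP[v Uv [n2 Nn2 ->]] := subvP SUN y Sy.
rewrite linearDr abU // add0r; apply: (subvP SN); apply: memv_bracket => //.
exact: (subvP US).
Qed.

End LeibnizAlgebras.

(** * The action of [M] on the abelian ideal [A] *)

Section LastDerivedTerm.

Variables (F : closedFieldType) (L : vectType F) (br : {bilinear L -> L -> L}).
Hypotheses (hLeib : right_leibniz br) (hA : is_A_algebra br).
Hypothesis hsol : is_solvable br.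
Variable k : nat.
Hypothesis Lk0 : derived_series br k.+2 = 0%VS.

Let A := derived_series br k.+1.
Let M := derived_series br k.
Let stable (V : {vspace L}) := forall v y, v \in V -> br v y \in V.

Lemma last_derived_abelian v w : v \in A -> w \in A -> br v w = 0.
Proof. by move=> Av Aw; apply/eqP; rewrite -memv0 -Lk0 memv_bracket. Qed.

Lemma last_derived_comm v x y :
  v \in A -> x \in M -> y \in M -> br (br v x) y = br (br v y) x.
Proof.
move=> Av Mx My; rewrite (rmul_derivation hLeib v x y).
by rewrite (last_derived_abelian Av (derived_series_br Mx My)) add0r.
Qed.

(* For S = <x> + A the algebra N = [S, S] lies in A and N = [N, S] = [N, x],  *)
(* so right multiplication by x is injective on N, which contains [v, x].     *)
Lemma last_derived_null v x :
  v \in A -> x \in M -> br (br v x) x = 0 -> br v x = 0.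
Proof.
move=> Av Mx vxx0; pose S := (<[x]> + A)%VS.
have AM : (A <= M)%VS by apply: derived_series_desc.
have SM : (S <= M)%VS by rewrite subv_add -memvE Mx.
have SSA : (bracketv br S S <= A)%VS by apply: bracketvS.
have algS : is_subalgebra br S by apply: subv_trans SSA (addvSr _ _).
have Sx : x \in S by rewrite (subvP (addvSl _ _)) ?memv_line.
have Sv : v \in S by rewrite (subvP (addvSr _ _)).
have stN := A_algebra_derived_stable hLeib hA hsol algS.
set N := bracketv br S S in SSA stN.
have Nx : (N <= rmul br x @: N)%VS.
  rewrite -{1}stN; apply/bracketvP => n s Nn.
  move=> /memv_addP[_ /vlineP[c ->] [a Aa ->]].
  rewrite linearDr linearZr_LR (last_derived_abelian _ Aa) ?(subvP SSA) //.
  by rewrite addr0 -rmulE memvZ ?memv_img.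
have kerN : (N :&: lker (rmul br x))%VS == 0%VS.
  rewrite -dimv_eq0 -leqn0 -(leq_add2r (\dim (rmul br x @: N))).
  by rewrite limg_ker_dim add0n dimvS.
apply/eqP; rewrite -memv0 -(eqP kerN) memv_cap memv_ker rmulE vxx0 eqxx andbT.
exact: memv_bracket.
Qed.

(* With t = u - c w for a common eigenvector of w and u, the kernel of t is   *)
(* L-stable because it is also the kernel of its square.                      *)
Lemma proportional_submodule (V : {vspace L}) w u :
    (V <= A)%VS -> V != 0%VS -> stable V -> w \in M -> u \in M ->
    (forall v, v \in V -> br v w = 0 -> v = 0) ->
  exists c, exists V' : {vspace L}, [/\ (V' <= V)%VS, V' != 0%VS, stable V' &
    forall v, v \in V' -> br v u = c *: br v w].
Proof.
move=> VA V0 stV Mw Mu injw.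
have stab x : (rmul br x @: V <= V)%VS.
  by apply/subvP=> _ /memv_imgP[v Vv ->]; rewrite rmulE stV.
have [a [v Vv [v_neq0]]] := exists_eigenvector V0 (stab w).
rewrite rmulE => vw.
have a_neq0 : a != 0.
  apply: contraNneq v_neq0 => a0; apply/eqP/injw => //.
  by rewrite vw a0 scale0r.
pose Va := (V :&: lker (rmul br w - a *: \1%VF)%R)%VS.
have VaP x : reflect (x \in V /\ br x w = a *: x) (x \in Va).
  rewrite memv_cap memv_ker add_lfunE opp_lfunE scale_lfunE id_lfunE.
  rewrite rmulE subr_eq0.
  by apply: (iffP andP) => -[? /eqP].
have Va0 : Va != 0%VS.
  apply: contraNneq v_neq0 => Va0; rewrite -memv0 -Va0; exact/VaP.
(* [w] and [u] commute on [A], so [u] preserves the eigenspace of [w]. *)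
have Vau : (rmul br u @: Va <= Va)%VS.
  apply/subvP=> _ /memv_imgP[x /VaP[Vx xw] ->]; rewrite rmulE; apply/VaP.
  by rewrite stV // last_derived_comm ?(subvP VA) // xw linearZl_LR.
have [b [{v vw v_neq0}v /VaP[{}Vv vw] [v_neq0]]] := exists_eigenvector Va0 Vau.
rewrite rmulE => vu.
pose c := b / a; pose t := u - c *: w.
have Mt : t \in M by rewrite memvB ?memvZ.
have brt x : br x t = br x u - c *: br x w by rewrite linearBr linearZr_LR.
exists c, (V :&: lker (rmul br t))%VS; split.
- exact: capvSl.
- apply: contraNneq v_neq0 => V'0; rewrite -memv0 -V'0.
  rewrite memv_cap Vv memv_ker rmulE brt vu vw scalerA mulfVK //.
  by rewrite subrr eqxx.
(* If [[x, t] = 0] then [[[x, y], t] = [x, [y, t]]]. As [[y, t]] lies in [M], it commutes with [t]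
   on [A], so a second [t] gives 0. *)
- move=> x y; rewrite !memv_cap !memv_ker !rmulE => /andP[Vx /eqP xt].
  rewrite stV //=; apply/eqP; have Ax := subvP VA x Vx.
  apply: last_derived_null => //; first by rewrite (subvP VA) ?stV.
  rewrite (rmul_derivation hLeib x y t) xt linear0l addr0.
  rewrite last_derived_comm ?xt ?linear0l //.
  exact: derived_series_brr.
move=> x; rewrite memv_cap memv_ker rmulE brt subr_eq0.
by case/andP=> _ /eqP.
Qed.

Lemma last_derived_br_commutator v x y z :
  v \in A -> x \in M -> br v (br x (br y z)) = 0.
Proof.
move=> Av Mx; move Dw: (br x (br y z)) => w.
have Mw : w \in M by rewrite -Dw; apply: derived_series_brl.
suffices Aw : (A <= lker (rmul br w))%VS.
  by have := subvP Aw v Av; rewrite memv_ker rmulE => /eqP.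
apply: contraT => notAw; pose V := (rmul br w @: A)%VS.
have stA : stable A by move=> a s; apply: derived_series_brl.
have VA : (V <= A)%VS.
  by apply/subvP=> _ /memv_imgP[a Aa ->]; rewrite rmulE stA.
have V0 : V != 0%VS by rewrite -lkerE.
have injA a : a \in A -> br (br a w) w = 0 -> br a w = 0.
  by move=> Aa; apply: last_derived_null.
have injV a : a \in V -> br a w = 0 -> a = 0.
  by case/memv_imgP=> b Ab ->; rewrite !rmulE; apply: injA.
have VwV : (V <= rmul br w @: V)%VS.
  rewrite (_ : (rmul br w @: V = V)%VS) //; apply/eqP.
  rewrite eqEdim; apply/andP; split.
    by apply: limgS.
  rewrite limg_dim_eq //; apply/eqP; rewrite -subv0; apply/subvP=> a.
  by rewrite memv_cap memv_ker rmulE memv0 => /andP[/injV h /eqP/h ->].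
(* For [b = [b', w]], both terms of [[[b, w], s] = [b, [w, s]] + [[b, s], w]] lie in [[A, w]], the
   first since [[w, s]] and [w] commute on [A]. *)
have stV : stable V.
  move=> a s /(subvP VwV)/memv_imgP[b Vb ->]; have Ab := subvP VA b Vb.
  rewrite rmulE (rmul_derivation hLeib b w s).
  have [b' Ab' ->] := memv_imgP Vb; rewrite rmulE.
  rewrite last_derived_comm // ?derived_series_brl // -!rmulE.
  by rewrite memvD // memv_img // !rmulE !stA.
have refine u (W : {vspace L}) :
    u \in M -> (W <= V)%VS -> W != 0%VS -> stable W ->
  exists c, exists W' : {vspace L}, [/\ (W' <= W)%VS, W' != 0%VS, stable W' &
    forall a, a \in W' -> br a u = c *: br a w].
  move=> Mu WV W0 stW; apply: proportional_submodule => //.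
    exact: subv_trans WV VA.
  by move=> a /(subvP WV); apply: injV.
have [c [V1 [V1V V10 st1 c1]]] := refine x V Mx (subvv _) V0 stV.
have Mwy : br w y \in M by apply: derived_series_brl.
have Mwz : br w z \in M by apply: derived_series_brl.
have [p [V2 [V21 V20 st2 c2]]] := refine _ V1 Mwy V1V V10 st1.
have V2V := subv_trans V21 V1V.
have [q [V3 [V32 V30 st3 c3]]] := refine _ V2 Mwz V2V V20 st2.
have {}c1 a : a \in V3 -> br a x = c *: br a w.
  by move=> /(subvP V32)/(subvP V21)/c1.
have {}c2 a : a \in V3 -> br a (br w y) = p *: br a w by move=> /(subvP V32)/c2.
case/negP: V30; rewrite -subv0; apply/subvP=> a V3a; rewrite memv0; apply/eqP.
apply: injV; first exact: (subvP V2V) (subvP V32 a V3a).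
(* [x] acts as [c w] on all of the stable [V3], so it may be replaced by [c w] inside a bracket. *)
have brw s : br a (br x s) = c *: br a (br w s).
  by rewrite !hLeib !c1 ?st3 // linearZl_LR scalerBr.
rewrite -{1}Dw brw.
have -> : br a (br w (br y z)) = br a (br (br w y) z) - br a (br (br w z) y).
  by rewrite (hLeib w y z) linearBr.
(* The two brackets act as [p q w] and [q p w], so their difference is 0. *)
rewrite (hLeib a (br w y) z) (hLeib a (br w z) y) !c2 ?st3 // !c3 ?st3 //.
rewrite !linearZl_LR -!scalerBr -!hLeib c2 // c3 //.
by rewrite !scalerA [q * p]mulrC subrr scaler0.
Qed.

End LastDerivedTerm.

Theorem theorem7p1 (F : closedFieldType) (L : vectType F)
    (br : {bilinear L -> L -> L}) (hLeib : right_leibniz br)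
    (hA : is_A_algebra br) (hsol : is_solvable br) :
  (derived_length hsol <= 3)%N.
Proof.
rewrite leqNgt; apply/negP => n_gt3.
have [Ln0 /(_ (ltnW (ltnW (ltnW n_gt3))))] := (derived_lengthP hsol _).1 erefl.
(* With length [k + 4], the terms [A], [M], [Q] have indices [k.+3], [k.+2], [k.+1]. *)
move: Ln0; rewrite -(subnK n_gt3); set k := (_ - 4)%N; rewrite addn4 => Lk0.
apply.
have derived_stable l : bracketv br (derived_series br l.+1)
    (derived_series br l) = derived_series br l.+1.
  apply: (A_algebra_derived_stable hLeib hA hsol); apply/bracketvP => x y Lx _.
  exact: derived_series_brl.
rewrite -(derived_stable k.+2); apply/eqP; rewrite -subv0.
rewrite -(derived_stable k.+1).
apply: bracketv_subr => v x q Av Mx Qq.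
have /subvP/(_ q Qq) := derived_series_desc hLeib (isT : (1 <= k.+1)%N).
(* [[v, [x, q]]] is linear in [q], so it suffices to treat [q = [y, z]]. *)
suffices /subvP sub : (derived_series br 1 <=
    lker (linfun (br v) \o linfun (br x)))%VS.
  by move=> /sub; rewrite memv_ker comp_lfunE !lfunE memv0.
apply/bracketvP => y z _ _; rewrite memv_ker comp_lfunE !lfunE /=.
by rewrite (last_derived_br_commutator hLeib hA hsol Lk0).
Qed.
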